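(* Let $G$ be a finite abelian group with $|G|>2$, let $H$ be a subgroup of $G$ with $H\neq G$, and let $k=|H|$. Let $X$ be either of the two complement graphs $\overline{\Gamma^+_{G,H}}$, $\overline{\Gamma_{G,H}}$. Then $X$ is connected and has diameter at most $2$, with equality except when $X$ is the graph $\overline{\Gamma_{G,\{0\}}}$ (which is complete). If $k>2$, then the radius of $X$ equals its diameter, that is, $X$ is self-centred.
   Context: Groups are written additively with identity $0$. For a finite abelian group $G$ and a subgroup $H$, $\Gamma^+_{G,H}$ (the extended subgroup sum graph) is the simple graph with vertex set $G$ in which distinct $x,y$ are adjacent iff $x+y\in H$; $\Gamma_{G,H}$ (the subgroup sum graph) is the simple graph with vertex set $G$ in which distinct $x,y$ are adjacent iff $x+y\in H\setminus\{0\}$. $\overline{\Gamma}$ denotes the complement of a graph $\Gamma$. The eccentricity of a vertex is its maximum distance to another vertex; the radius and diameter of a graph are the minimum and maximum eccentricities; a graph is self-centred if its radius equals its diameter. *)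

(* Defs.v *)
From mathcomp Require Import all_boot all_order all_fingroup all_algebra.

Set Implicit Arguments.
Unset Strict Implicit.
Unset Printing Implicit Defensive.

Import GRing.Theory.

Record sgraph (T : finType) := SGraph {
  adj :> rel T;
  adj_sym : symmetric adj;
  adj_irr : irreflexive adj
}.

Section Graphs.
Variable T : finType.
Implicit Types (X : sgraph T) (x y : T) (n : nat).

Definition compl_adj X : rel T := fun x y => (x != y) && ~~ X x y.

Lemma compl_sym X : symmetric (compl_adj X).
Proof. by move=> x y; rewrite /compl_adj eq_sym adj_sym. Qed.

Lemma compl_irr X : irreflexive (compl_adj X).
Proof. by move=> x; rewrite /compl_adj eqxx. Qed.

Definition compl X : sgraph T := SGraph (@compl_sym X) (@compl_irr X).

Definition complete X : Prop := forall x y, x != y -> X x y.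

Definition connected X : Prop := forall x y, connect X x y.

Definition walk X x y n : bool :=
  [exists p : n.-tuple T, path X x p && (last x p == y)].

(* A shortest walk repeats no vertex, so the least length of a walk from x to y
   is < #|T| when there is one; the value #|T| stands for an infinite distance. *)
Definition dist X x y : nat := find (walk X x y) (iota 0 #|T|).

Definition ecc X x : nat := \max_(y | y != x) dist X x y.

Definition diam X : nat := \max_x ecc X x.

(* Eccentricities are at most #|T|, so #|T| is neutral for this minimum. *)
Definition radius X : nat := \big[minn/#|T|]_x ecc X x.

Definition self_centred X : Prop := radius X = diam X.

Lemma walkP X x y n :
  reflect (exists p, [/\ size p = n, path X x p & last x p = y]) (walk X x y n).
Proof.
apply: (iffP existsP) => [[p /andP[pp /eqP pl]]|[p [sp pp pl]]].
  by exists p; rewrite size_tuple.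
by exists (tcast sp (in_tuple p)); rewrite val_tcast /= pp pl eqxx.
Qed.

Lemma dist_walk X x y : connect X x y -> walk X x y (dist X x y).
Proof.
case/connectP=> p /shortenP[q pq uq _] ->.
have ltq : size q < #|T| by have := max_card [in x :: q]; rewrite (card_uniqP uq).
have hw : has (walk X x (last x q)) (iota 0 #|T|).
  by apply/hasP; exists (size q); [rewrite mem_iota | apply/walkP; exists q].
have ltf : find (walk X x (last x q)) (iota 0 #|T|) < #|T|.
  by move: hw; rewrite has_find size_iota.
by have := nth_find 0 hw; rewrite nth_iota.
Qed.

Lemma dist_min X x y n : walk X x y n -> n < #|T| -> dist X x y <= n.
Proof.
move=> wn ltn; rewrite leqNgt; apply/negP => lt.
by have := before_find 0 lt; rewrite nth_iota // wn.
Qed.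

Lemma dist_le_card X x y : dist X x y <= #|T|.
Proof. by rewrite -[leqRHS](size_iota 0); exact: find_size. Qed.

End Graphs.

Section SumGraphs.
Variables (G : finZmodType) (H : {set G}).
Local Open Scope ring_scope.

Definition ext_sum_adj : rel G := fun x y => (x != y) && (x + y \in H).

Lemma ext_sum_sym : symmetric ext_sum_adj.
Proof. by move=> x y; rewrite /ext_sum_adj eq_sym addrC. Qed.

Lemma ext_sum_irr : irreflexive ext_sum_adj.
Proof. by move=> x; rewrite /ext_sum_adj eqxx. Qed.

Definition ext_sum_graph : sgraph G := SGraph ext_sum_sym ext_sum_irr.

Definition sum_adj : rel G := fun x y => (x != y) && (x + y \in H :\ 0).

Lemma sum_sym : symmetric sum_adj.
Proof. by move=> x y; rewrite /sum_adj eq_sym addrC. Qed.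

Lemma sum_irr : irreflexive sum_adj.
Proof. by move=> x; rewrite /sum_adj eqxx. Qed.

Definition sum_graph : sgraph G := SGraph sum_sym sum_irr.

End SumGraphs.

(* Main.v *)
Require Import Defs.
From mathcomp Require Import all_boot all_order all_fingroup all_algebra.

(** Two vertices [x], [y] whose sum lies in [H] are both in [H] or both outside
    it. In the first case every element outside [H] is a common neighbour of
    [x] and [y] in the complement of the extended subgroup sum graph; in the
    second case [0] is one ([ext_common_neighbour]). The complement of the
    subgroup sum graph has the same vertices and at least those edges, so in
    both graphs non-adjacent vertices have a common neighbour. Such a graph is
    connected, its distances are at most 2, and a distance of 2 is attained
    precisely by the pairs of distinct non-adjacent vertices; so the diameter
    is 2 unless the graph is complete, i.e., unless it is the complement of the
    subgroup sum graph of the trivial subgroup.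

    If [2 < #|H|], any vertex [x] has a non-neighbour: choose [h] in [H]
    distinct from [0] and [x + x], and take [h - x]. Every eccentricity is then
    equal to 2, whence the equality of radius and diameter. *)

Set Implicit Arguments.
Unset Strict Implicit.
Unset Printing Implicit Defensive.

Import GRing.Theory.

Section TwoStepGraphs.
Variables (T : finType) (X : sgraph T).
(* A computed distance of 2 is a genuine one only if it is less than [#|T|]. *)
Hypothesis cardT : 2 < #|T|.
Hypothesis common_neighbour :
  forall x y, x != y -> ~~ X x y -> exists z, X x z && X z y.

Lemma two_step_connected : connected X.
Proof.
move=> x y; have [->|nxy] := eqVneq x y; first exact: connect0.
have [/connect1//|nX] := boolP (X x y).
have [z /andP[xz zy]] := common_neighbour nxy nX.
exact: connect_trans (connect1 xz) (connect1 zy).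
Qed.

Lemma dist_adj x y : X x y -> dist X x y <= 1.
Proof.
move=> xy; apply: dist_min; last exact: ltnW.
by apply/walkP; exists [:: y]; rewrite /= xy.
Qed.

Lemma two_step_dist x y : x != y -> dist X x y <= 2.
Proof.
move=> nxy; have [/dist_adj/leqW//|nX] := boolP (X x y).
have [z /andP[xz zy]] := common_neighbour nxy nX.
by apply: dist_min => //; apply/walkP; exists [:: z; y]; rewrite /= xz zy.
Qed.

Lemma two_step_dist_nadj x y : x != y -> ~~ X x y -> 1 < dist X x y.
Proof.
move=> nxy nX; have := dist_walk (two_step_connected x y).
case: (dist X x y) => [|[|//]] /walkP[p []].
  by move/size0nil=> -> /= _ exy; rewrite exy eqxx in nxy.
by case: p => [|z [|//]] //= _ /andP[xz _] ezy; rewrite -ezy xz in nX.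
Qed.

Lemma two_step_ecc x : ecc X x <= 2.
Proof. by apply/bigmax_leqP => y nyx; apply: two_step_dist; rewrite eq_sym. Qed.

Lemma two_step_ecc_nadj x y : x != y -> ~~ X x y -> ecc X x = 2.
Proof.
move=> nxy nX; apply/eqP; rewrite eqn_leq two_step_ecc /=.
apply: leq_trans (two_step_dist_nadj nxy nX) _.
by apply: (bigmax_sup y); rewrite // eq_sym.
Qed.

Lemma two_step_diam : diam X <= 2.
Proof. by apply/bigmax_leqP => x _; apply: two_step_ecc. Qed.

Lemma complete_diam : complete X -> diam X <= 1.
Proof.
move=> cX; apply/bigmax_leqP => x _; apply/bigmax_leqP => y nyx.
by apply/dist_adj/cX; rewrite eq_sym.
Qed.

Lemma two_step_diam_nadj x y : x != y -> ~~ X x y -> diam X = 2.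
Proof.
move=> nxy nX; apply/eqP; rewrite eqn_leq two_step_diam /=.
by rewrite -(two_step_ecc_nadj nxy nX); apply: (bigmax_sup x).
Qed.

Lemma two_step_diam2 : diam X = 2 <-> ~ complete X.
Proof.
split=> [d2 /complete_diam|ncX]; first by rewrite d2.
have [/forallP cX|] := boolP [forall x, forall y, (x != y) ==> X x y].
  by case: ncX => x y nxy; have /forallP/(_ y)/implyP := cX x; apply.
case/forallPn=> x /forallPn[y]; rewrite negb_imply => /andP[nxy nX].
exact: two_step_diam_nadj nxy nX.
Qed.

Lemma two_step_self_centred :
  (forall x, exists2 y, x != y & ~~ X x y) -> self_centred X.
Proof.
move=> nadj; have ecc2 x : ecc X x = 2.
  by have [y nxy nX] := nadj x; apply: two_step_ecc_nadj nxy nX.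
have /card_gt0P[x0 _] : 0 < #|T| by apply: ltn_trans cardT.
have [y nxy nX] := nadj x0; rewrite /self_centred (two_step_diam_nadj nxy nX).
apply/eqP; rewrite eqn_leq; apply/andP; split.
  rewrite /radius; case: (index_enum T) (mem_index_enum x0) => [|x s] // _.
  by rewrite big_cons ecc2 geq_minl.
rewrite /radius; elim/big_rec: _ => [|x m _ le2m]; first exact: ltnW.
by rewrite ecc2 leq_min le2m.
Qed.

End TwoStepGraphs.

Section SumGraphs.
Variables (G : finZmodType) (H : {group G}).
Local Open Scope ring_scope.

(** [groupMl], with the group law of [G] written additively. *)
Lemma groupDl x y : x \in H -> (x + y \in H) = (y \in H).
Proof. exact: groupMl. Qed.

Lemma ext_common_neighbour x y :
  H :!=: [set: G] -> x + y \in H ->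
  exists2 z, x + z \notin H & z + y \notin H.
Proof.
move=> nHG xyH; have [xH|xH] := boolP (x \in H).
  have yH : y \in H by rewrite -(groupDl y xH).
  have /subsetPn[z _ zH] : ~~ ([set: G] \subset H).
    by apply: contra nHG => sGH; rewrite eqEsubset subsetT.
  by exists z; rewrite ?(addrC z) groupDl.
exists 0; rewrite ?addr0 ?add0r //; apply: contra xH => yH.
by rewrite -(groupDl x yH) addrC.
Qed.

Lemma ext_common_neighbour_adj x y :
  H :!=: [set: G] -> x != y -> x + y \in H ->
  exists z, compl (ext_sum_graph H) x z && compl (ext_sum_graph H) z y.
Proof.
move=> nHG nxy xyH; have [z xz zy] := ext_common_neighbour nHG xyH.
exists z; rewrite /= /compl_adj /= /ext_sum_adj (negPf xz) (negPf zy) !andbF.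
rewrite !andbT; apply/andP; split.
  (* [z = x] would give [x + y] outside [H], and likewise for [z = y]. *)
  by apply: contraNneq zy => <-.
by apply: contraNneq xz => ->.
Qed.

Lemma sub_compl_sum x y :
  compl (ext_sum_graph H) x y -> compl (sum_graph H) x y.
Proof.
case/andP=> nxy; rewrite /= /ext_sum_adj nxy /= => xyH.
by rewrite /compl_adj nxy /= /sum_adj in_setD1 (negPf xyH) !andbF.
Qed.

Lemma compl_sum_trivial (x y : G) : compl (sum_graph [set 0]) x y = (x != y).
Proof.
by rewrite /= /compl_adj /= /sum_adj in_setD1 in_set1 andNb andbF andbT.
Qed.

Lemma sum_neighbour x : (2 < #|H|)%N -> exists2 y, x != y & x + y \in H :\ 0.
Proof.
move=> cardH; have /subsetPn[h hH] : ~~ (H \subset [set 0; x + x]).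
  apply/negP => /subset_leq_card/(leq_trans cardH).
  by rewrite cards2; case: (_ != _).
rewrite !inE negb_or => /andP[h0 hxx]; exists (h - x).
  by apply: contraNneq hxx => {2}->; rewrite addrC subrK.
by rewrite addrC subrK in_setD1 h0.
Qed.

End SumGraphs.

Theorem corollary4p2 (G : finZmodType) (H : {group G}) (X : sgraph G)
    (cardG : 2 < #|G|) (HneqG : H :!=: [set: G])
    (defX : X = compl (ext_sum_graph H) \/ X = compl (sum_graph H)) :
  [/\ connected X,
      diam X <= 2,
      diam X = 2 <-> ~ (X =2 compl (sum_graph [set 0%R])),
      complete (compl (sum_graph ([set 0%R] : {set G})))
    & 2 < #|H| -> self_centred X].
Proof.
have subX x y : compl (ext_sum_graph H) x y -> X x y.
  by case: defX => -> //; apply: sub_compl_sum.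
have nadjX x y : x != y -> (x + y)%R \in H :\ 0%R -> ~~ X x y.
  rewrite in_setD1 => nxy /andP[xy0 xyH].
  case: defX => ->; rewrite /= /compl_adj /= ?/ext_sum_adj ?/sum_adj.
    by rewrite nxy xyH.
  by rewrite nxy in_setD1 xy0 xyH.
have cnX x y : x != y -> ~~ X x y -> exists z, X x z && X z y.
  move=> nxy nX; have xyH : (x + y)%R \in H.
    apply: contraNT nX => xyH; apply: subX.
    by rewrite /= /compl_adj /= /ext_sum_adj nxy (negPf xyH).
  have [z /andP[xz zy]] := ext_common_neighbour_adj HneqG nxy xyH.
  by exists z; rewrite !subX.
have completeX : complete X <-> X =2 compl (sum_graph [set 0%R]).
  split=> [cX x y | eX x y nxy]; last by rewrite eX compl_sum_trivial.
  rewrite compl_sum_trivial; have [->|/cX//] := eqVneq x y.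
  exact: adj_irr.
split.
- exact: two_step_connected.
- exact: two_step_diam.
- apply: iff_trans (two_step_diam2 cardG cnX) _.
  by split=> nX /completeX.
- by move=> x y nxy; rewrite compl_sum_trivial.
- move=> cardH; apply: two_step_self_centred => // x.
  by have [y nxy /(nadjX _ _ nxy)] := sum_neighbour x cardH; exists y.
Qed.
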